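(* Let $a,b,c,d,e,f\in\mathbb{R}$, and let $\mathcal{X}$ be the vector field on $\mathcal{H}$ given by $$\mathcal{X}(x,y,z)=\left(ax+by,\; cx+dy,\; ex+fy+(a+d)z\right).$$ Let $K=\{(x,y,z)\in\mathcal{H}: y=z=0\}$ and let $\pi_K:\mathcal{H}\to\mathcal{H}/K$ be the canonical projection. If $a+d\neq 0$ and $e\neq 0$, then the pair $(\mathcal{X},\pi_K)$ is observable.
   Context: $\mathcal{H}$ denotes the three-dimensional Heisenberg group, realized as $\mathbb{R}^3$ with the product $$(x,y,z)\cdot(w,s,t)=(x+w+yt,\;y+s,\;z+t),$$ with identity element $(0,0,0)$. The linear vector fields on $\mathcal{H}$ considered are those of the form $\mathcal{X}(x,y,z)=(ax+by,\,cx+dy,\,ex+fy+(a+d)z)$ with real constants $a,b,c,d,e,f$ (here $e$ is a real number, not the group identity). Let $\varphi_t$ denote the flow of $\mathcal{X}$, i.e. $t\mapsto\varphi_t(p)$ is the solution of $\dot p=\mathcal{X}(p)$ with initial condition $p$ at $t=0$. For a subgroup $K\subset\mathcal{H}$, $\pi_K:\mathcal{H}\to\mathcal{H}/K$ denotes the canonical projection $g\mapsto gK$, which is viewed as the output map. The pair $(\mathcal{X},\pi_K)$ is observable at $p_1\in\mathcal{H}$ if for every $p_2\in\mathcal{H}\setminus\{p_1\}$ there exists $t\geq 0$ such that $\pi_K(\varphi_t(p_1))\neq\pi_K(\varphi_t(p_2))$. It is observable if it is observable at every point of $\mathcal{H}$. *)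

(* Defs.v *)
From HB Require Import structures.
From mathcomp Require Import all_boot all_order all_algebra.
From mathcomp Require Import all_classical all_reals all_analysis.
From mathcomp Require Import ring.

Set Implicit Arguments.
Unset Strict Implicit.
Unset Printing Implicit Defensive.

Import Order.TTheory GRing.Theory Num.Theory.
Import numFieldNormedType.Exports.

Local Open Scope classical_set_scope.
Local Open Scope ring_scope.

(* An alias of R^3, so that its (noncommutative) group law is kept apart from
   the additive structure of the vector space [R * R * R]. *)
Definition heisenberg (R : realType) : Type := (R * R * R)%type.

HB.instance Definition _ (R : realType) :=
  Choice.copy (heisenberg R) (R * R * R)%type.

Section Heisenberg_group.
Variable R : realType.
Implicit Types p q : heisenberg R.

Definition heis_one : heisenberg R := (0, 0, 0).

Definition heis_mul p q : heisenberg R :=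
  let: (x, y, z) := p in let: (w, s, t) := q in
  (x + w + y * t, y + s, z + t).

Definition heis_inv p : heisenberg R :=
  let: (x, y, z) := p in (- x + y * z, - y, - z).

Fact heis_mulA : associative heis_mul.
Proof.
by move=> [[x y] z] [[w s] t] [[u v] r] /=; congr (_, _, _); ring.
Qed.

Fact heis_mul1g : left_id heis_one heis_mul.
Proof. by move=> [[x y] z] /=; rewrite mul0r addr0 !add0r. Qed.

Fact heis_mulg1 : right_id heis_one heis_mul.
Proof. by move=> [[x y] z] /=; rewrite mulr0 !addr0. Qed.

Fact heis_mulVg : left_inverse heis_one heis_inv heis_mul.
Proof.
move=> [[x y] z] /=; congr (_, _, _); rewrite ?addNr //.
by rewrite mulNr addrAC addrK addNr.
Qed.

Fact heis_mulgV : right_inverse heis_one heis_inv heis_mul.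
Proof.
move=> [[x y] z] /=; congr (_, _, _); rewrite ?subrr //.
by rewrite mulrN addrA subrr add0r subrr.
Qed.

End Heisenberg_group.

HB.instance Definition _ (R : realType) :=
  isGroup.Build (heisenberg R) (@heis_mulA R) (@heis_mul1g R) (@heis_mulg1 R)
    (@heis_mulVg R) (@heis_mulgV R).

Definition xaxis (R : realType) : {pred heisenberg R} :=
  fun p => let: (_, y, z) := p in (y == 0) && (z == 0).

Fact xaxis_group_closed (R : realType) : group_closed (@xaxis R).
Proof.
split=> [|[[x y] z] [[w s] t]]; first by rewrite unfold_in /= eqxx.
rewrite !unfold_in /= => /andP[/eqP-> /eqP->] /andP[/eqP-> /eqP->].
by rewrite subrr eqxx.
Qed.

HB.instance Definition _ (R : realType) :=
  isMulClosed.Build (heisenberg R) (@xaxis R)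
    (group_closedM (@xaxis_group_closed R)).
HB.instance Definition _ (R : realType) :=
  isMul1Closed.Build (heisenberg R) (@xaxis R) (@xaxis_group_closed R).1.
HB.instance Definition _ (R : realType) :=
  isInvClosed.Build (heisenberg R) (@xaxis R)
    (group_closedV (@xaxis_group_closed R)).

(* The quotient G / K is the set of left cosets g K, each coset being
   represented by its underlying subset of G. *)
Definition coset_proj (G : groupType) (K : groupClosed G) (g : G) : set G :=
  [set (g * k)%g | k in [set k | k \in K]].

Definition linear_field (R : realType) (a b c d e f : R) (p : heisenberg R) :
    R * R * R :=
  let: (x, y, z) := p in
  (a * x + b * y, c * x + d * y, e * x + f * y + (a + d) * z).

Definition is_flow (R : realType) (X : heisenberg R -> R * R * R)
    (phi : R -> heisenberg R -> heisenberg R) : Prop :=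
  forall p : heisenberg R,
    phi 0 p = p /\
    forall t : R, is_derive t 1 (fun s : R => phi s p : R * R * R) (X (phi t p)).

Definition observable_at (R : realType) (T Y : Type) (phi : R -> T -> T)
    (h : T -> Y) (p1 : T) : Prop :=
  forall p2 : T, p2 <> p1 ->
    exists t : R, 0 <= t /\ h (phi t p1) <> h (phi t p2).

Definition observable (R : realType) (T Y : Type) (phi : R -> T -> T)
    (h : T -> Y) : Prop :=
  forall p1 : T, observable_at phi h p1.

(* Main.v *)
Require Import Defs.
From HB Require Import structures.
From mathcomp Require Import all_boot all_order all_algebra.
From mathcomp Require Import all_classical all_reals all_analysis.

(** Right multiplication by (k, 0, 0) moves a point of the Heisenberg group
    to (x + k, y, z), so the cosets of K are the lines parallel to the x-axis
    and the output is equivalent to the pair (y, z) ([xaxis_coset_projP]).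
    Suppose that two trajectories have the same outputs for all t >= 0.  Their
    initial points then share y and z, and their z-coordinates, being equal on
    the half-line t >= 0, have equal derivatives at 0 ([is_derive_eq_right]).
    These derivatives are e x + f y + (a + d) z at the initial points; after
    cancelling the terms in y and z, the hypothesis on e gives that x is shared
    as well: a single differentiation of the output recovers the state. *)

Set Implicit Arguments.
Unset Strict Implicit.
Unset Printing Implicit Defensive.

Import Order.TTheory GRing.Theory Num.Theory.
Import numFieldNormedType.Exports.

Local Open Scope classical_set_scope.
Local Open Scope ring_scope.

Lemma is_derive_snd (R : realType) (V W : normedModType R)
    (g : R -> V * W) (t : R) (l : V * W) :
  is_derive t 1 g l -> is_derive t 1 (fun s => (g s).2) l.2.
Proof.
move=> [gd gl].
have gq : (h^-1 *: ((g \o shift t) (h *: 1) - g t)).2 @[h --> 0^'] --> l.2.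
  apply: (@cvg_comp _ _ _ _ snd _ _ _ _ (cvg_snd (F := nbhs l.1))).
  by rewrite -gl; exact: gd.
split; first by apply/cvg_ex; exists l.2; exact: gq.
by apply: cvg_lim => //; exact: gq.
Qed.

(** A two-sided derivative is the limit of the difference quotients taken from
    the right alone, so it is determined by the values on a right half-line. *)
Lemma is_derive_eq_right (R : realType) (V : normedModType R)
    (g1 g2 : R -> V) (t : R) (l1 l2 : V) :
  is_derive t 1 g1 l1 -> is_derive t 1 g2 l2 ->
  (forall s, t <= s -> g1 s = g2 s) -> l1 = l2.
Proof.
move=> [d1 <-] [d2 <-] g12.
have right_quotient (g : R -> V) : derivable g t 1 ->
    h^-1 *: ((g \o shift t) (h *: 1) - g t) @[h --> 0^'+] --> 'D_1 g t.
  by move=> dg; exact: cvg_dnbhs_at_right dg.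
rewrite -(cvg_lim (@norm_hausdorff _ _) (right_quotient _ d1)).
apply: cvg_lim => //.
apply: cvg_trans (right_quotient _ d2); apply: near_eq_cvg.
near=> h => /=.
rewrite !g12 // scaler1 lerDr; apply: ltW; near: h; exact: nbhs_right_gt.
Unshelve. all: by end_near. Qed.

Lemma xaxis_coset_projP (R : realType) (x y z w s t : R) :
  coset_proj (@xaxis R) ((x, y, z) : heisenberg R) =
    coset_proj (@xaxis R) ((w, s, t) : heisenberg R) ->
  y = s /\ z = t.
Proof.
move=> cosetE.
have : coset_proj (@xaxis R) ((x, y, z) : heisenberg R) (x, y, z).
  by exists 1%g; [exact: gpred1 | exact: mulg1].
rewrite cosetE => -[[[k1 k2] k3]] /=.
rewrite unfold_in /= => /andP[/eqP-> /eqP->] [_ <- <-].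
by rewrite !addr0.
Qed.

Theorem proposition3p2 (R : realType) (a b c d e f : R)
    (phi : R -> heisenberg R -> heisenberg R)
    (hphi : is_flow (linear_field a b c d e f) phi)
    (had : a + d != 0) (he : e != 0) :
  observable phi (coset_proj (@xaxis R)).
Proof.
move=> p1 p2 p21; apply: contrapT => no_time; apply: p21.
have out t : 0 <= t -> coset_proj (@xaxis R) (phi t p1) =
                       coset_proj (@xaxis R) (phi t p2).
  by move=> t0; apply: contrapT => ne; apply: no_time; exists t.
have zE t : 0 <= t -> (phi t p1 : R * R * R).2 = (phi t p2 : R * R * R).2.
  move=> /out; case: (phi t p1) (phi t p2) => [[? ?] ?] [[? ?] ?].
  by case/xaxis_coset_projP.
have [i1 /(_ 0) /is_derive_snd D1] := hphi p1.
have [i2 /(_ 0) /is_derive_snd D2] := hphi p2.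
have := is_derive_eq_right D1 D2 zE.
have := out 0 (lexx 0); rewrite i1 i2.
case: p1 p2 {no_time out zE i1 i2 D1 D2} => [[x y] z] [[w s] t].
case/xaxis_coset_projP => -> -> /=.
by move=> /addIr /addIr /(mulfI he) ->.
Qed.
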